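(* Let $\{\lambda_k\}_{k=1}^n$ and $\{\mu_j\}_{j=1}^{n-1}$ be two sequences of complex numbers. Then the system of inequalities $$\frac{\prod_{j=1}^{n-1}(\mu_j-\lambda_k)}{\prod_{1\le j\le n,\ j\ne k}(\lambda_j-\lambda_k)}\ge 0,\qquad k\in\{1,\ldots,n\},$$ is valid if and only if there exists a normal matrix $A\in M_n(\mathbb{C})$ with the spectrum $\sigma(A)=\{\lambda_1,\ldots,\lambda_n\}$ such that the spectrum of $A_{n-1}$ is $\sigma(A_{n-1})=\{\mu_1,\ldots,\mu_{n-1}\}$.
   Context: For an $n\times n$ matrix $A$, $A_{n-1}$ is the principal $(n-1)\times(n-1)$ submatrix obtained by deleting the last row and column. $\sigma(\cdot)$ is the spectrum, with eigenvalues listed according to algebraic multiplicity. An inequality $c\ge0$ for a complex quantity $c$ means that $c$ is real and nonnegative.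
   Formalization: When some λ_k are repeated the displayed denominator vanishes; the quotient is then read as the value at z=λ_k of ∏(μ_j−z)/∏_{j≠k}(λ_j−z) after cancelling common factors, and the inequality counts as failing if a pole remains. *)

(* Defs.v *)
(* The complex numbers are R[i] for R : realType, whose order
   satisfies: 0 <= c iff c is real and nonnegative. *)
From mathcomp Require Import all_boot all_order all_algebra.
From mathcomp Require Import complex reals.

Set Implicit Arguments.
Unset Strict Implicit.
Unset Printing Implicit Defensive.

Import Order.TTheory GRing.Theory Num.Theory.
Local Open Scope ring_scope.

(* s lists the eigenvalues of A, each repeated according to its algebraic
   multiplicity, i.e. its multiplicity as a root of the characteristic
   polynomial. *)
Definition is_spectrum (C : fieldType) (m : nat) (A : 'M[C]_m)
    (s : 'I_m -> C) : Prop :=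
  forall z : C, #|[set i | s i == z]| = mup z (char_poly A).

Definition del_last (C : fieldType) (n : nat) (A : 'M[C]_n.+1) : 'M[C]_n :=
  row' ord_max (col' ord_max A).

(* The rational function p / q is regular at a, with value c there. *)
Definition ratfun_value (C : fieldType) (p q : {poly C}) (a c : C) : Prop :=
  exists u v : {poly C}, [/\ v.[a] != 0, p * v = u * q & c = u.[a] / v.[a]].

(* Nothing forbids repeated values among the lam j, in which case the
   denominator \prod_(j | j != k) (lam j - lam k) vanishes for some k. (Division
   by zero being total in MathComp, the raw quotient would then be 0, and the
   inequality vacuous.) The quotient is therefore read as the value at
   z = lam k of the rational function
     \prod_j (mu j - z) / \prod_(j | j != k) (lam j - z),
   i.e. common factors are cancelled, and the inequality fails if a pole
   remains. When the denominator does not vanish, this is the displayed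
   quotient: see quotient_is_literal and quotient_ge0_literal. *)
Definition quotient_is (C : fieldType) (n : nat) (lam : 'I_n.+1 -> C)
    (mu : 'I_n -> C) (k : 'I_n.+1) (c : C) : Prop :=
  ratfun_value (\prod_(j < n) ((mu j)%:P - 'X))
               (\prod_(j < n.+1 | j != k) ((lam j)%:P - 'X)) (lam k) c.

Definition quotient_ge0 (C : numFieldType) (n : nat) (lam : 'I_n.+1 -> C)
    (mu : 'I_n -> C) (k : 'I_n.+1) : Prop :=
  exists2 c : C, quotient_is lam mu k c & 0 <= c.

Lemma ratfun_value_inj (C : fieldType) (p q : {poly C}) (a c d : C) :
  q != 0 -> ratfun_value p q a c -> ratfun_value p q a d -> c = d.
Proof.
move=> q0 [u [v [va E ->]]] [u' [v' [va' E' ->]]].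
have H : u * v' = u' * v.
  by apply: (mulIf q0); rewrite mulrAC -E [RHS]mulrAC -E' mulrAC.
apply/eqP; rewrite eqr_div //.
by rewrite -!hornerM H.
Qed.

Lemma quotient_is_literal (C : fieldType) (n : nat) (lam : 'I_n.+1 -> C)
    (mu : 'I_n -> C) (k : 'I_n.+1) (c : C) :
  \prod_(j < n.+1 | j != k) (lam j - lam k) != 0 ->
  quotient_is lam mu k c <->
  c = \prod_(j < n) (mu j - lam k) / \prod_(j < n.+1 | j != k) (lam j - lam k).
Proof.
set p := \prod_(j < n) ((mu j)%:P - 'X).
set q := \prod_(j < n.+1 | j != k) ((lam j)%:P - 'X).
have -> : \prod_(j < n) (mu j - lam k) = p.[lam k].
  by rewrite horner_prod; apply: eq_bigr => j _; rewrite !hornerE.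
have -> : \prod_(j < n.+1 | j != k) (lam j - lam k) = q.[lam k].
  by rewrite horner_prod; apply: eq_bigr => j _; rewrite !hornerE.
move=> qk.
have V : ratfun_value p q (lam k) (p.[lam k] / q.[lam k]) by exists p, q.
split=> [H|-> //]; apply: ratfun_value_inj H V.
by apply: contraNneq qk => q0; rewrite /q q0 horner0.
Qed.

Lemma quotient_ge0_literal (C : numFieldType) (n : nat) (lam : 'I_n.+1 -> C)
    (mu : 'I_n -> C) (k : 'I_n.+1) :
  \prod_(j < n.+1 | j != k) (lam j - lam k) != 0 ->
  quotient_ge0 lam mu k <->
  0 <= \prod_(j < n) (mu j - lam k) / \prod_(j < n.+1 | j != k) (lam j - lam k).
Proof.
move=> qk; split=> [[c /(quotient_is_literal mu _ qk) -> //]|H].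
by eexists; [apply/(quotient_is_literal mu _ qk)|].
Qed.

(* Main.v *)
(** Write [A = P^-1 D P] with [P] unitary and [D] diagonal. The last diagonal
    entry of the adjugate of [z - A] gives the characteristic polynomial of
    [A_{n-1}] as [\sum_k w k * \prod_(j != k) (z - lam j)] with
    [w k = |P k n|^2]. Dividing by [\prod_j (z - lam j)], the quotient of the
    [k]-th inequality is the residue at [lam k], that is, the sum of the [w i]
    over all [i] with [lam i = lam k], hence nonnegative. Conversely the
    residues determine the partial fraction decomposition, so nonnegative
    quotients yield nonnegative weights, each residue being shared equally
    among the indices with the same [lam]. The weights add up to 1 by comparing
    leading coefficients, and any such weights are the squared moduli of a
    column of some unitary matrix, by Gram-Schmidt. *)
Require Import Defs.
From mathcomp Require Import all_boot all_order all_fingroup all_algebra.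
From mathcomp Require Import complex reals.
Import Order.TTheory GRing.Theory Num.Theory.
Local Open Scope ring_scope.

Set Implicit Arguments.
Unset Strict Implicit.
Unset Printing Implicit Defensive.

(** * Spectra as factorizations of the characteristic polynomial *)

Lemma prod_XsubC_dvdp (F : fieldType) (I : Type) (r : seq I) (s : I -> F)
    (p : {poly F}) :
  (forall z, mup z (\prod_(i <- r) ('X - (s i)%:P)) <= mup z p)%N ->
  \prod_(i <- r) ('X - (s i)%:P) %| p.
Proof.
elim: r p => [|i r IHr] p le_rp; first by rewrite big_nil dvd1p.
have [->|p0] := eqVneq p 0; first by rewrite dvdp0.
have r0 : \prod_(j <- r) ('X - (s j)%:P) != 0.
  exact/monic_neq0/monic_prod_XsubC.
have mup_cons z : mup z (\prod_(j <- i :: r) ('X - (s j)%:P)) =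
    (mup z ('X - (s i)%:P) + mup z (\prod_(j <- r) ('X - (s j)%:P)))%N.
  by rewrite big_cons mupM ?polyXsubC_eq0.
have /dvdpP[q Dp] : 'X - (s i)%:P %| p.
  rewrite XsubC_dvd //; apply: leq_trans (le_rp (s i)).
  by rewrite mup_cons -['X - _]expr1 mup_XsubCX eqxx.
have q0 : q != 0 by apply: contraNneq p0 => q0; rewrite Dp q0 mul0r.
(* Cancelling the common linear factor lowers both multiplicities by the same amount, so the
   hypothesis passes to [q]. *)
rewrite big_cons Dp mulrC dvdp_mul // IHr // => z.
have := le_rp z.
by rewrite mup_cons Dp mupM ?polyXsubC_eq0 // addnC leq_add2r.
Qed.

Lemma mup_prod_ord (F : fieldType) (n : nat) (s : 'I_n -> F) (z : F) :
  mup z (\prod_i ('X - (s i)%:P)) = #|[set i | s i == z]|.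
Proof.
have -> : \prod_i ('X - (s i)%:P) = \prod_(x <- codom s) ('X - x%:P).
  by rewrite codomE big_map big_enum.
rewrite mu_prod_XsubC codomE count_map cardsE cardE size_filter.
by rewrite enumT; apply: eq_count.
Qed.

Lemma size_prod_ord_XsubC (F : fieldType) (n : nat) (s : 'I_n -> F) :
  size (\prod_i ('X - (s i)%:P)) = n.+1.
Proof. by rewrite size_prod_XsubC /index_enum -enumT size_enum_ord. Qed.

(** The multiplicities make the product divide the characteristic polynomial; both are monic of
    degree [n], hence equal. *)
Lemma is_spectrumP (F : fieldType) (n : nat) (A : 'M[F]_n) (s : 'I_n -> F) :
  is_spectrum A s <-> char_poly A = \prod_i ('X - (s i)%:P).
Proof.
split=> [sA|eA z]; last by rewrite eA mup_prod_ord.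
apply/esym/eqP; rewrite -eqp_monic ?char_poly_monic ?monic_prod_XsubC //.
rewrite -dvdp_size_eqp ?size_char_poly ?size_prod_ord_XsubC //.
by apply: prod_XsubC_dvdp => z; rewrite -sA mup_prod_ord.
Qed.

(** * Characteristic polynomials of conjugated diagonal matrices *)

Lemma char_poly_mx_diag_conj (F : fieldType) (n : nat) (P : 'M[F]_n)
    (d : 'rV[F]_n) :
  P \in unitmx ->
  char_poly_mx (invmx P *m diag_mx d *m P) =
  map_mx polyC (invmx P) *m diag_mx (\row_k ('X - (d 0 k)%:P))
    *m map_mx polyC P.
Proof.
move=> uP; rewrite /char_poly_mx !map_mxM.
have QQ : map_mx polyC (invmx P) *m map_mx polyC P = 1%:M.
  by rewrite -map_mxM mulVmx // map_mx1.
have -> : diag_mx (\row_k ('X - (d 0 k)%:P)) =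
          'X%:M - map_mx polyC (diag_mx d).
  by apply/matrixP=> i j; rewrite !mxE; case: eqP; rewrite ?subr0 ?mulr0n.
rewrite mulmxBr mulmxBl scalar_mxC -[_ *m map_mx _ (invmx P) *m _]mulmxA.
by rewrite QQ mulmx1.
Qed.

Lemma char_poly_diag_conj (F : fieldType) (n : nat) (P : 'M[F]_n)
    (d : 'rV[F]_n) :
  P \in unitmx ->
  char_poly (invmx P *m diag_mx d *m P) = \prod_i ('X - (d 0 i)%:P).
Proof.
move=> uP; rewrite /char_poly char_poly_mx_diag_conj // !det_mulmx.
rewrite mulrAC -det_mulmx -map_mxM mulVmx // map_mx1 det1 mul1r det_diag.
by apply: eq_bigr => i _; rewrite mxE.
Qed.

Lemma char_poly_del_last_diag_conj (F : fieldType) (n : nat) (P : 'M[F]_n.+1)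
    (d : 'rV[F]_n.+1) :
  P \in unitmx ->
  char_poly (del_last (invmx P *m diag_mx d *m P)) =
  \sum_k (invmx P ord_max k * P k ord_max) *:
         \prod_(j | j != k) ('X - (d 0 j)%:P).
Proof.
move=> uP; set A := invmx P *m _ *m P.
pose Q := map_mx polyC P; pose Q' := map_mx polyC (invmx P).
have QQ : Q' *m Q = 1%:M by rewrite -map_mxM mulVmx // map_mx1.
have QQ' : Q *m Q' = 1%:M by rewrite -map_mxM mulmxV // map_mx1.
pose Dl := diag_mx (\row_k ('X - (d 0 k)%:P)).
pose E := diag_mx (\row_k \prod_(j | j != k) ('X - (d 0 j)%:P)).
have ZA : char_poly_mx A = Q' *m Dl *m Q by exact: char_poly_mx_diag_conj.
have DE : Dl *m E = (char_poly A)%:M.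
  rewrite char_poly_diag_conj //; apply/matrixP=> i j.
  rewrite mul_diag_mx !mxE; case: eqP => [->|_]; rewrite ?mulr0 //.
  by rewrite !mulr1n [RHS](bigD1 j).
have ZE : char_poly_mx A *m (Q' *m E *m Q) = (char_poly A)%:M.
  rewrite ZA !mulmxA -[Q' *m Dl *m Q *m Q']mulmxA QQ' mulmx1.
  by rewrite -[Q' *m Dl *m E]mulmxA DE scalar_mxC -mulmxA QQ mulmx1.
(* Multiplying [ZE] on the left by the adjugate gives this identity times the nonzero polynomial
   [char_poly A], which cancels entrywise. *)
have adjE : \adj (char_poly_mx A) = Q' *m E *m Q.
  have := congr1 (mulmx (\adj (char_poly_mx A))) ZE.
  rewrite mulmxA mul_adj_mx -/(char_poly A) mul_scalar_mx mul_mx_scalar.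
  move=> e; apply/matrixP=> i j; move/matrixP: e => /(_ i j).
  rewrite !mxE => /mulfI -> //; exact/monic_neq0/char_poly_monic.
move/matrixP: adjE => /(_ ord_max ord_max).
rewrite mxE /cofactor row'_col'_char_poly_mx -signr_odd oddD addbb mul1r.
rewrite -/(char_poly _) -/(del_last A) => ->.
rewrite mul_mx_diag mxE; apply: eq_bigr => k _; rewrite !mxE.
by rewrite mulrAC -polyCM mul_polyC.
Qed.

(** * Partial fractions and their residues *)

Lemma prod_XsubC_deleted (F : fieldType) (n : nat) (s : 'I_n -> F) (k : 'I_n) :
  ('X - (s k)%:P) * \prod_(j | j != k) ('X - (s j)%:P) =
  \prod_j ('X - (s j)%:P).
Proof. by rewrite [RHS](bigD1 k). Qed.

(** Serves both for repeated values in one list ([s = t]) and for two orderings of the same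
    spectrum. *)
Lemma eq_prod_XsubC_deleted (F : fieldType) (n : nat) (s t : 'I_n -> F)
    (k l : 'I_n) :
  \prod_j ('X - (s j)%:P) = \prod_j ('X - (t j)%:P) -> s k = t l ->
  \prod_(j | j != k) ('X - (s j)%:P) = \prod_(j | j != l) ('X - (t j)%:P).
Proof.
move=> est ekl; apply: (mulfI (negbT (polyXsubC_eq0 (s k)))).
by rewrite {2}ekl !prod_XsubC_deleted.
Qed.

Lemma size_prod_XsubC_deleted (F : fieldType) (n : nat) (s : 'I_n.+1 -> F)
    (k : 'I_n.+1) :
  size (\prod_(j | j != k) ('X - (s j)%:P)) = n.+1.
Proof.
have := size_prod_ord_XsubC s; rewrite -(prod_XsubC_deleted s k).
rewrite mulrC size_Mmonic ?monicXsubC ?monic_neq0 ?monic_prod_XsubC //.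
by rewrite size_XsubC addn2 => -[].
Qed.

Lemma ratfun_valueD (F : fieldType) (p p' q : {poly F}) (a c c' : F) :
  ratfun_value p q a c -> ratfun_value p' q a c' ->
  ratfun_value (p + p') q a (c + c').
Proof.
move=> [u [v [va E ->]]] [u' [v' [va' E' ->]]].
exists (u * v' + u' * v), (v * v'); split.
- by rewrite hornerM mulf_neq0.
- rewrite !mulrDl (mulrA p) E (mulrC v) (mulrA p') E' mulrAC.
  by rewrite [u' * q * v]mulrAC.
- by rewrite hornerD !hornerM addf_div.
Qed.

Lemma ratfun_valueZ (F : fieldType) (p q : {poly F}) (a b c : F) :
  ratfun_value p q a c -> ratfun_value (b *: p) q a (b * c).
Proof.
move=> [u [v [va E ->]]]; exists (b *: u), v; split=> //.
  by rewrite -!scalerAl E.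
by rewrite hornerZ mulrA.
Qed.

Lemma ratfun_value_signr (F : fieldType) (p q : {poly F}) (a c : F) (m : nat) :
  ratfun_value ((-1) ^+ m * p) ((-1) ^+ m * q) a c <-> ratfun_value p q a c.
Proof.
split=> -[u [v [va E ->]]]; exists u, v; split=> //.
  by apply: (can_inj (signrMK m)); rewrite mulrA E mulrCA.
by rewrite -mulrA E mulrCA.
Qed.

(** Numerator and denominator both have [n] factors, so negating all of them multiplies both by the
    same sign. *)
Lemma quotient_is_monic (F : fieldType) (n : nat) (lam : 'I_n.+1 -> F)
    (mu : 'I_n -> F) (k : 'I_n.+1) (c : F) :
  quotient_is lam mu k c <->
  ratfun_value (\prod_j ('X - (mu j)%:P))
               (\prod_(j | j != k) ('X - (lam j)%:P)) (lam k) c.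
Proof.
rewrite /quotient_is.
have prodE m (s : 'I_m -> F) (P : pred 'I_m) :
    \prod_(j in P) ((s j)%:P - 'X) =
    (-1) ^+ #|P| * \prod_(j in P) ('X - (s j)%:P).
  by rewrite -prodrN; apply: eq_bigr => j _; rewrite opprB.
have := prodE _ mu predT; rewrite card_ord => ->.
have := prodE _ lam (predC1 k); rewrite cardC1 card_ord /= => ->.
exact: ratfun_value_signr.
Qed.

(** A product with [s i = s k] equals the denominator and has quotient 1; any other has quotient
    [('X - s k) / ('X - s i)], which vanishes at [s k]. *)
Lemma ratfun_value_partial_fraction (F : fieldType) (n : nat)
    (s w : 'I_n -> F) (k : 'I_n) :
  ratfun_value (\sum_i w i *: \prod_(j | j != i) ('X - (s j)%:P))
               (\prod_(j | j != k) ('X - (s j)%:P)) (s k)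
               (\sum_(i | s i == s k) w i).
Proof.
rewrite [\sum_(i | s i == s k) w i]big_mkcond /=.
set q := \prod_(j | j != k) _.
pose rv p c := ratfun_value p q (s k) c.
apply: (big_ind2 rv); rewrite /rv; last 1 first.
- move=> i _; have [eik|neik] := eqVneq (s i) (s k).
    rewrite -[in X in ratfun_value _ _ _ X](mulr1 (w i)).
    apply: ratfun_valueZ; exists 1, 1; rewrite hornerC divr1 oner_neq0.
    by rewrite mulr1 mul1r /q (eq_prod_XsubC_deleted _ eik).
  rewrite -(mulr0 (w i)); apply: ratfun_valueZ.
  exists ('X - (s k)%:P), ('X - (s i)%:P); rewrite !hornerXsubC subrr mul0r.
  by rewrite subr_eq0 eq_sym neik mulrC !prod_XsubC_deleted.
- by exists 0, 1; rewrite !hornerC oner_neq0 !mul0r.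
- by move=> ? ? ? ?; apply: ratfun_valueD.
Qed.

(* Each factor ['X - s k] divides [p] with its full multiplicity in
   [\prod_j ('X - s j)], whose degree exceeds that of [p]. *)
Lemma ratfun_value_eq0 (F : fieldType) (n : nat) (s : 'I_n -> F)
    (p : {poly F}) :
  (size p <= n)%N ->
  (forall k, ratfun_value p (\prod_(j | j != k) ('X - (s j)%:P)) (s k) 0) ->
  p = 0.
Proof.
move=> le_pn p0; apply/eqP/negPn/negP=> nz_p.
suff /dvdp_leq -/(_ nz_p) : \prod_j ('X - (s j)%:P) %| p.
  by rewrite size_prod_ord_XsubC ltnNge le_pn.
apply: prod_XsubC_dvdp => z.
have [k /eqP szk|noz] := pickP (fun i => s i == z).
  (* The value 0 makes [u] divisible by ['X - z], which completes the deleted product to the full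
     one; [v] does not vanish at [z], so [p] and [p * v] have the same multiplicity there. *)
  have [u [v [vz pv /esym/eqP]]] := p0 k; rewrite szk in vz pv *.
  rewrite mulf_eq0 invr_eq0 (negPf vz) orbF => /factor_theorem[u' Du].
  rewrite -(@mupMl _ _ p v vz) pv Du -mulrA -szk prod_XsubC_deleted.
  rewrite mupM ?leq_addl //.
    apply: contraNneq nz_p => u0; move: pv; rewrite Du u0 !mul0r => /eqP.
    by rewrite mulf_eq0 => /orP[//|/eqP v0]; rewrite v0 horner0 eqxx in vz.
  exact/monic_neq0/monic_prod_XsubC.
rewrite mup_prod_ord; suff -> : [set i | s i == z] = set0 by rewrite cards0.
by apply/setP=> i; rewrite !inE noz.
Qed.

(** * From nonnegative quotients to a unitary matrix *)

Lemma unitarymx_col_sqr_norm (C : numClosedFieldType) (n : nat) (i : 'I_n.+1)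
    (w : 'I_n.+1 -> C) :
  (forall k, 0 <= w k) -> \sum_k w k = 1 ->
  exists2 P : 'M[C]_n.+1,
    P \is unitarymx & forall k, (P k i)^* * P k i = w k.
Proof.
move=> w0 w1; pose A : 'M[C]_n.+1 := \matrix_(_, j) sqrtC (w j).
pose S := schmidt A.
have uS : S \is unitarymx by apply: schmidt_unitarymx.
(* Gram-Schmidt keeps the line of the first row, the only row of [A] that matters. *)
have [a Da] : exists a, row 0 A = a *: row 0 S.
  apply/sub_rVP; apply: submx_trans (row_schmidt_sub _ _) _.
  apply/sumsmx_subP=> j; rewrite leqn0 => /eqP j0.
  by rewrite genmxE (_ : j = 0) //; apply: val_inj.
have Dw k : w k = (a^* * a) * ((S 0 k)^* * S 0 k).
  have /rowP/(_ k) := Da; rewrite !mxE => Dk.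
  rewrite mulrACA -rmorphM -Dk /= (geC0_conj (_ : 0 <= sqrtC (w k))).
    by rewrite -expr2 sqrtCK.
  by rewrite sqrtC_ge0.
have a1 : a^* * a = 1.
  have S1 : \sum_k (S 0 k)^* * S 0 k = 1.
    move/unitarymxP/matrixP: uS => /(_ 0 0); rewrite !mxE eqxx mulr1n => <-.
    by apply: eq_bigr => k _; rewrite !mxE mulrC.
  by rewrite -w1 -[LHS]mulr1 -S1 mulr_sumr; apply: eq_bigr => k _; rewrite Dw.
(* Row 0 of [S] is moved to position [i], then transposed into column [i]. *)
exists (row_perm (tperm 0 i) S)^T.
  rewrite trmx_unitary; apply/row_unitarymxP=> j k.
  have rowE l : row l (row_perm (tperm 0 i) S) = row (tperm 0 i l) S.
    by apply/rowP=> m; rewrite !mxE.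
  by rewrite !rowE (row_unitarymxP uS) (inj_eq perm_inj).
by move=> k; rewrite !mxE tpermR Dw a1 mul1r.
Qed.

Lemma quotient_ge0_weights (C : numFieldType) (n : nat)
    (lam : 'I_n.+1 -> C) (mu : 'I_n -> C) :
  (forall k, quotient_ge0 lam mu k) ->
  exists w : 'I_n.+1 -> C,
    [/\ forall k, 0 <= w k, \sum_k w k = 1 &
        \prod_j ('X - (mu j)%:P) =
        \sum_i w i *: \prod_(j | j != i) ('X - (lam j)%:P)].
Proof.
move=> ge0_quot.
have [c cV c0] := fin_all_exists2 ge0_quot.
have {}cV k := (quotient_is_monic lam mu k (c k)).1 (cV k).
pose m k := #|[set i | lam i == lam k]|%:R : C.
have m_gt0 k : 0 < m k.
  by rewrite ltr0n; apply/card_gt0P; exists k; rewrite inE.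
pose w k := c k / m k.
have w0 k : 0 <= w k by rewrite divr_ge0 // ltW.
have sum_w k : \sum_(i | lam i == lam k) w i = c k.
  (* Indices with equal [lam] have the same denominator, so uniqueness of the value gives them the
     same [c]. *)
  have wE i : lam i == lam k -> w i = c k / m k.
    move=> /eqP eik; rewrite /w /m eik; congr (_ / _).
    apply: ratfun_value_inj (cV k); first exact/monic_neq0/monic_prod_XsubC.
    by rewrite -eik -(eq_prod_XsubC_deleted _ eik).
  rewrite (eq_bigr _ wE) sumr_const -[_ *+ _]mulr_natr /m cardsE.
  by rewrite mulfVK //; have := m_gt0 k; rewrite /m cardsE lt0r => /andP[].
have muE : \prod_j ('X - (mu j)%:P) =
    \sum_i w i *: \prod_(j | j != i) ('X - (lam j)%:P).
  (* The difference of the two sides has degree at most [n] and value [c k - c k = 0] at each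
     [lam k]. *)
  apply/eqP; rewrite -subr_eq0; apply/eqP; apply: (@ratfun_value_eq0 _ _ lam).
    rewrite (leq_trans (size_polyD _ _)) // size_polyN geq_max.
    rewrite size_prod_ord_XsubC leqnn (leq_trans (size_sum _ _ _)) //.
    apply/bigmax_leqP => i _.
    by rewrite (leq_trans (size_scale_leq _ _)) ?size_prod_XsubC_deleted.
  move=> k; rewrite -(subrr (c k)); apply: ratfun_valueD (cV k) _.
  rewrite -[- c k]mulN1r -sum_w -scaleN1r; apply: ratfun_valueZ.
  exact: ratfun_value_partial_fraction.
have w1 : \sum_k w k = 1.
  (* All products in [muE] are monic of degree [n]. *)
  have := congr1 (fun p : {poly C} => p`_n) muE; rewrite /= coef_sum.
  have monicE (p : {poly C}) : p \is monic -> size p = n.+1 -> p`_n = 1.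
    by move=> /monicP <- szp; rewrite lead_coefE szp.
  rewrite monicE ?monic_prod_XsubC ?size_prod_ord_XsubC // => ->.
  apply: eq_bigr => k _; rewrite coefZ monicE ?mulr1 ?monic_prod_XsubC //.
  exact: size_prod_XsubC_deleted.
by exists w.
Qed.

Theorem proposition3p1 (R : realType) (n : nat)
    (lam : 'I_n.+1 -> R[i]) (mu : 'I_n -> R[i]) :
  (forall k : 'I_n.+1, quotient_ge0 lam mu k) <->
  (exists A : 'M[R[i]]_n.+1,
     [/\ A \is normalmx, is_spectrum A lam & is_spectrum (del_last A) mu]).
Proof.
split=> [ge0_quot | [A [/orthomx_spectralP]]].
  have [w [w0 w1 muE]] := quotient_ge0_weights ge0_quot.
  have [P uP Pw] := unitarymx_col_sqr_norm ord_max w0 w1.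
  pose d := \row_k lam k.
  have dE (Q : pred 'I_n.+1) :
      \prod_(k | Q k) ('X - (d 0 k)%:P) = \prod_(k | Q k) ('X - (lam k)%:P).
    by apply: eq_bigr => k _; rewrite mxE.
  exists (invmx P *m diag_mx d *m P); split.
  - by apply/orthomx_spectral_subproof; exists (P, d).
  - by apply/is_spectrumP; rewrite char_poly_diag_conj ?unitarymx_unit // dE.
  - apply/is_spectrumP; rewrite char_poly_del_last_diag_conj ?unitarymx_unit //.
    rewrite muE; apply: eq_bigr => k _; rewrite dE invmx_unitary // -Pw.
    by rewrite !mxE.
set P := spectralmx A; set d := spectral_diag A => DA.
have uP : P \in unitmx by apply: spectral_unit.
rewrite DA => /is_spectrumP; rewrite char_poly_diag_conj // => lamE.
move=> /is_spectrumP; rewrite char_poly_del_last_diag_conj // => muE k.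
(* The spectral decomposition lists the eigenvalues in its own order, so [lam k] is located in [d]
   as a root of the common characteristic polynomial. *)
have [l dl] : exists l, d 0 l = lam k.
  have : root (\prod_i ('X - (d 0 i)%:P)) (lam k).
    by rewrite lamE -(prod_XsubC_deleted lam k) rootM root_XsubC eqxx.
  rewrite rootE horner_prod => /prodf_eq0[l _].
  by rewrite hornerXsubC subr_eq0 => /eqP; exists l.
eexists.
  apply/quotient_is_monic; rewrite -(eq_prod_XsubC_deleted lamE dl) -dl -muE.
  exact: ratfun_value_partial_fraction.
(* As [P] is unitary, each weight is the squared modulus of an entry of its last column. *)
apply: sumr_ge0 => i _; rewrite invmx_unitary ?spectral_unitarymx //.
by rewrite !mxE mulrC mul_conjC_ge0.
Qed.
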